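(* Let $K$ be a compact (Hausdorff) space. Then the following conditions are equivalent: (i) $K$ is monotonically monolithic; (ii) $K$ is monotonically $\omega$-monolithic; (iii) $K$ is monotonically Sokolov.
   Context: All spaces are Hausdorff. For a space $T$, $\tau(T)$ is its topology and $\tau(x,T)=\{U\in\tau(T): x\in U\}$. A family $\mathcal N$ of subsets of $T$ is an external network of $A\subset T$ in $T$ if for every $a\in A$ and $U\in\tau(a,T)$ there is $N\in\mathcal N$ with $a\in N\subset U$. Given an infinite cardinal $\kappa$, a space $T$ is monotonically $\kappa$-monolithic if to every $A\subset T$ with $|A|\le\kappa$ one can assign an external network $\mathcal O(A)$ of $\overline{A}$ in $T$ such that: (1) $|\mathcal O(A)|\le |A|+\omega$; (2) if $A\subset B\subset T$ and $|B|\le\kappa$ then $\mathcal O(A)\subset\mathcal O(B)$; (3) if $\lambda\le\kappa$ is a cardinal and $\{A_\alpha:\alpha<\lambda\}$ are subsets of $T$ of cardinality $\le\kappa$ with $A_\alpha\subset A_\beta$ for $\alpha<\beta<\lambda$, then $\mathcal O(\bigcup_{\alpha<\lambda}A_\alpha)=\bigcup_{\alpha<\lambda}\mathcal O(A_\alpha)$. $T$ is monotonically monolithic if it is monotonically $\kappa$-monolithic for every infinite cardinal $\kappa$. Let $X,Y$ be sets, $\mathcal O$ a family of subsets of $X$ closed under countable increasing unions, $\mathcal N$ a family of subsets of $Y$, and $f:\mathcal O\to\mathcal N$. Then $f$ is $\omega$-monotone if: (a) $f(A)$ is countable for every countable $A\in\mathcal O$; (b) $A\subset B$, $A,B\in\mathcal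 O$ imply $f(A)\subset f(B)$; (c) if $A_n\in\mathcal O$ and $A_n\subset A_{n+1}$ for all $n\in\omega$ then $f(\bigcup_n A_n)=\bigcup_n f(A_n)$. A space $T$ is monotonically Sokolov if to every countable family $\mathcal F$ of closed subsets of $T$ one can assign a continuous retraction $r_{\mathcal F}:T\to T$ and a countable external network $\mathcal N(\mathcal F)$ of $r_{\mathcal F}(T)$ in $T$ such that $r_{\mathcal F}(F)\subset F$ for every $F\in\mathcal F$ and the assignment $\mathcal F\mapsto\mathcal N(\mathcal F)$ is $\omega$-monotone. *)

(* Defs.v *)
From HB Require Import structures.
From mathcomp Require Import all_boot all_order.
From mathcomp Require Import all_classical all_reals all_analysis.
Set Implicit Arguments. Unset Strict Implicit. Unset Printing Implicit Defensive.
Local Open Scope classical_set_scope.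
Local Open Scope card_scope.

(* An infinite cardinal kappa is represented by an (arbitrary) infinite type
   K; |A| <= kappa means A #<= [set: K]. *)
Definition infinite_type (K : Type) : Prop := infinite_set [set: K].

Definition external_network {T : topologicalType} (Nf : set (set T)) (A : set T) :=
  forall a, A a -> forall U : set T, open U -> U a ->
    exists2 N, Nf N & N a /\ N `<=` U.

(* A cardinal lambda, represented as an initial well-ordered type (W, lt):
   a strict total well-order each of whose proper initial segments has
   strictly smaller cardinality than W. *)
Definition cardinal_wo (W : Type) (lt : W -> W -> Prop) : Prop :=
  [/\ (forall x, ~ lt x x),
      (forall x y z, lt x y -> lt y z -> lt x z),
      (forall x y, x = y \/ lt x y \/ lt y x),
      well_founded lt &
      (forall w, ~ ([set: W] #<= [set v | lt v w]))].

Definition mono_kappa_monolithic (T : topologicalType) (K : Type) : Prop :=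
  exists O : set T -> set (set T),
  [/\ (forall A, A #<= [set: K] -> external_network (O A) (closure A)),
      (forall A, A #<= [set: K] ->
         O A #<= ([set inl a | a in A] `|` [set inr n | n in [set: nat]]
                  : set (T + nat)%type)),
      (forall A B, A `<=` B -> B #<= [set: K] -> O A `<=` O B) &
      (forall (W : Type) (lt : W -> W -> Prop) (Ach : W -> set T),
         cardinal_wo lt -> [set: W] #<= [set: K] ->
         (forall a, Ach a #<= [set: K]) ->
         (forall a b, lt a b -> Ach a `<=` Ach b) ->
         O (\bigcup_(a in [set: W]) Ach a) =
         \bigcup_(a in [set: W]) O (Ach a))].

Definition mono_monolithic (T : topologicalType) : Prop :=
  forall K : Type, infinite_type K -> mono_kappa_monolithic T K.

Definition mono_omega_monolithic (T : topologicalType) : Prop :=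
  mono_kappa_monolithic T nat.

Definition omega_monotone {X Y : Type} (Dom : set (set X))
  (f : set X -> set Y) : Prop :=
  [/\ (forall A, Dom A -> countable A -> countable (f A)),
      (forall A B, Dom A -> Dom B -> A `<=` B -> f A `<=` f B) &
      (forall An : nat -> set X, (forall n, Dom (An n)) ->
         (forall n, An n `<=` An n.+1) ->
         f (\bigcup_n An n) = \bigcup_n f (An n))].

Arguments external_network {T}.
Definition countable_closed_families (T : topologicalType) : set (set (set T)) :=
  [set F | countable F /\ (forall C, F C -> closed C)].

Definition mono_Sokolov (T : topologicalType) : Prop :=
  exists (r : set (set T) -> T -> T) (Nw : set (set T) -> set (set T)),
  [/\ (forall F, @countable_closed_families T F ->
         [/\ continuous (r F),
             (forall x, r F (r F x) = r F x),
             countable (Nw F),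
             external_network (Nw F) (range (r F)) &
             (forall C, F C -> r F @` C `<=` C)]) &
      omega_monotone (@countable_closed_families T) Nw].

(* Main.v *)
(* Each of the three properties is equivalent to a finitary one: there is a map
   [e] from finite sequences of points and integers to subsets of [K] such that,
   for every countable [A], the sets [e s n] with [s] in [A] form an external
   network of the closure of [A].

   Continuity along countable chains reduces an assignment on countable sets to
   its values on finite sets; for a Sokolov assignment take the families of
   singletons of points of [A], whose retractions fix the closure of [A].

   Conversely, a countable set can be closed off so that it meets every nonempty
   intersection of a given closed set with finitely many sets [V s n], for [s] in
   the set itself.  With [V s n] a neighbourhood of a point [z] whose closure
   misses [e s n], compactness shows that [K] is countably tight, so [e] gives
   networks for all sets, of the right cardinality because an infinite set has as
   many finite sequences as elements.  With [V s n] given by Urysohn functions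
   separating members of the network, these functions separate the points of the
   closure of the closed-off set [A], and sending [x] to the point of that
   closure where they take the same values as at [x] is the required
   retraction. *)

Require Import Defs.
From mathcomp Require Import all_boot all_order all_algebra.
From mathcomp Require Import all_classical all_reals all_analysis.
From mathcomp Require Import Rstruct.
Set Implicit Arguments. Unset Strict Implicit. Unset Printing Implicit Defensive.
Import Order.TTheory GRing.Theory Num.Theory.
Import numFieldNormedType.Exports.
Local Open Scope classical_set_scope.
Local Open Scope card_scope.

(** * Cardinality of the set of finite sequences *)

(** Any choice of partners under [G] is injective on [A]. An empty [A] is treated apart, since [U]
    may then offer no default value for points outside [A]. *)
Lemma card_le_rel (T U : Type) (A : set T) (B : set U) (G : T -> U -> Prop) :
  (forall a, A a -> exists2 b, B b & G a b) ->
  (forall a a' b, A a -> A a' -> G a b -> G a' b -> a = a') -> A #<= B.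
Proof.
move=> tot inj; case: (pselect (exists a, A a)) => [[a0 /tot[b0 _ _]]|A0]; last first.
  suff -> : A = set0 by exact: card_ge0.
  by rewrite predeqE => a; split=> // Aa; case: A0; exists a.
have /choice[f fP] : forall a, exists b, A a -> B b /\ G a b.
  move=> a; case: (pselect (A a)) => [/tot[b Bb Gab]|nAa]; first by exists b.
  by exists b0.
apply: inj_card_le; apply: unsquash; apply/injfunPex; exists f.
  by move=> a /fP[].
move=> a a' /set_mem Aa /set_mem Aa' ff.
have [_ Ga] := fP _ Aa; have [_ Ga'] := fP _ Aa'.
by apply: inj Aa Aa' Ga _; rewrite ff.
Qed.

Lemma card_le_ex (T U : Type) (A : set T) (B : set U) : A #<= B -> A !=set0 ->
  exists f : T -> U, (forall a, A a -> B (f a)) /\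
    (forall a a', A a -> A a' -> f a = f a' -> a = a').
Proof.
elim/Ppointed: U => U in B *; first by rewrite !emptyE => -> [].
move=> /pcard_leP[f] _; exists f; split=> [a Aa|a a' Aa Aa' ff].
  exact: funS.
by apply: (@inj _ _ _ f); rewrite ?inE.
Qed.

(** Zorn's lemma on graphs of partial injections from [A] to [B]: if a maximal graph missed a point
    on each side, that pair could be added, so it is total on one side. *)
Lemma card_le_total (T U : Type) (A : set T) (B : set U) : A #<= B \/ B #<= A.
Proof.
pose P (G : set (T * U)) := [/\ forall p, G p -> A p.1 /\ B p.2,
  forall a b b', G (a, b) -> G (a, b') -> b = b' &
  forall a a' b, G (a, b) -> G (a', b) -> a = a'].
have [F FP Ftot|G [[Gsub Gfun Ginj] Gmax]] := @Zorn_bigcup _ P.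
  have common p q : (\bigcup_(X in F) X) p -> (\bigcup_(X in F) X) q ->
      exists2 X, F X & X p /\ X q.
    move=> [X FX Xp] [Y FY Yq]; have [XY|YX] := Ftot X Y FX FY.
      by exists Y => //; split=> //; apply: XY.
    by exists X => //; split=> //; apply: YX.
  split=> [p [X /FP[+ _ _]]|a b b' G1 G2|a a' b G1 G2]; first exact.
  - by have [X /FP[_ + _] [X1 X2]] := common _ _ G1 G2; apply; eauto.
  - by have [X /FP[_ _ +] [X1 X2]] := common _ _ G1 G2; apply; eauto.
case: (pselect (exists2 a, A a & forall b, ~ G (a, b))) => [[a Aa Ga]|domG].
  case: (pselect (exists2 b, B b & forall a, ~ G (a, b))) => [[b Bb Gb]|ranG].
    exfalso; apply: (Gmax (G `|` [set (a, b)])).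
      split=> [|H]; first exact: subsetUl.
      by apply: (Ga b); apply: H; right.
    split=> [p [/Gsub//|->//]|x y y'|x x' y].
    - move=> [Gxy|[xa yb]] [Gxy'|[xa' yb']].
      + exact: Gfun Gxy Gxy'.
      + by case: (Ga y); rewrite -xa'.
      + by case: (Ga y'); rewrite -xa.
      + by rewrite yb yb'.
    - move=> [Gxy|[xa yb]] [Gxy'|[xa' yb']].
      + exact: Ginj Gxy Gxy'.
      + by case: (Gb x); rewrite -yb'.
      + by case: (Gb x'); rewrite -yb.
      + by rewrite xa xa'.
  right; apply: (@card_le_rel _ _ _ _ (fun b a => G (a, b))).
  - move=> b Bb; apply: contrapT => H; apply: ranG; exists b => // a' Gab.
    by apply: H; exists a' => //; have [] := Gsub _ Gab.
  - by move=> b b' c _ _; apply: Gfun.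
left; apply: (@card_le_rel _ _ _ _ (fun a b => G (a, b))).
- move=> a Aa; apply: contrapT => H; apply: domG; exists a => // b Gab.
  by apply: H; exists b => //; have [] := Gsub _ Gab.
- by move=> a a' b _ _; apply: Ginj.
Qed.

Section InfiniteSquare.
Variable T : Type.

(* Graphs of injections [D * D -> D], where [D] is read off the diagonal. *)
Let dom (G : set (T * T * T)) : set T := [set x | exists z, G (x, x, z)].

Let square_graph (G : set (T * T * T)) :=
  [/\ forall p z z', G (p, z) -> G (p, z') -> z = z',
      forall p p' z, G (p, z) -> G (p', z) -> p = p',
      forall x y, dom G x -> dom G y -> exists z, G (x, y, z) &
      forall x y z, G (x, y, z) -> [/\ dom G x, dom G y & dom G z]].

(** Take a maximal injection [D * D -> D]. If the complement of [D] embeds in [D], then [T] embeds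
    in [D] and the injection transfers to [T]. Otherwise the complement contains a copy [S] of [D],
    and the injection extends to the union of [D] and [S], against maximality. *)
Lemma infinite_square_inj : [set: nat] #<= [set: T] ->
  exists g : T * T -> T, injective g.
Proof.
move=> natT.
have [ν [_ ν_inj']] := card_le_ex natT (ex_intro _ 0%N I).
have {ν_inj'} ν_inj : injective ν by move=> m n; exact: ν_inj'.
pose G0 : set (T * T * T) :=
  [set q | exists m n, q = (ν m, ν n, ν (choice.pickle (m, n)))].
have domG0 x : dom G0 x <-> exists n, x = ν n.
  split=> [[z [m [n [-> _ _]]]]|[n ->]]; first by exists m.
  by eexists; exists n, n.
have G0P : square_graph G0.
  split.
  - move=> p z z' [m [n [-> ->]]] [m' [n' [[+ +] ->]]].
    by move=> /ν_inj-> /ν_inj->.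
  - move=> p p' z [m [n [-> ->]]] [m' [n' [-> +]]].
    by move=> /ν_inj/(pcan_inj choice.pickleK) [-> ->].
  - by move=> x y /domG0[m ->] /domG0[n ->]; eexists; exists m, n.
  - by move=> x y z [m [n [-> -> ->]]]; split; apply/domG0; eexists.
(* Zorn's lemma is applied to what is added to [G0]. The empty chain is then bounded by [G0] itself,
   and every [ν n] stays in the domain; [ν 0] and [ν 1] serve as tags in the doubling. *)
pose P G := square_graph (G0 `|` G).
have [F FP Ftot|G [GP Gmax]] := @Zorn_bigcup _ P.
  case: (pselect (exists X, F X)) => [[X0 FX0]|F0]; last first.
    rewrite /P (_ : \bigcup_(X in F) X = set0) ?setU0//.
    by rewrite predeqE => x; split=> // -[X FX]; case: F0; exists X.
  pose H := G0 `|` \bigcup_(X in F) X.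
  have one p : H p -> exists2 X, F X & (G0 `|` X) p.
    move=> [G0p|[X FX Xp]]; first by exists X0 => //; left.
    by exists X => //; right.
  have mono X Y : X `<=` Y -> G0 `|` X `<=` G0 `|` Y.
    by move=> XY; apply: setUS.
  have two p q : H p -> H q -> exists2 X, F X & (G0 `|` X) p /\ (G0 `|` X) q.
    move=> /one[X FX Xp] /one[Y FY Yq]; have [XY|YX] := Ftot X Y FX FY.
      by exists Y => //; split=> //; apply: mono XY _ _.
    by exists X => //; split=> //; apply: mono YX _ _.
  have sub X : F X -> G0 `|` X `<=` H.
    by move=> FX; apply: setUS; exact: bigcup_sup.
  have subd X : F X -> dom (G0 `|` X) `<=` dom H.
    by move=> FX x [z /(sub X FX) Hz]; exists z.
  split.
  - move=> p z z' H1 H2; have [X /FP[+ _ _ _] [X1 X2]] := two _ _ H1 H2.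
    by apply; eauto.
  - move=> p p' z H1 H2; have [X /FP[_ + _ _] [X1 X2]] := two _ _ H1 H2.
    by apply; eauto.
  - move=> x y [z Hz] [z' Hz']; have [X FX [Xz Xz']] := two _ _ Hz Hz'.
    have [_ _ /(_ x y) + _] := FP X FX.
    by case; [exists z|exists z'|move=> t /(sub X FX) Ht; exists t].
  - move=> x y z /one[X FX Xxyz]; have [_ _ _ /(_ _ _ _ Xxyz)[dx dy dz]] := FP X FX.
    by split; apply: (subd X FX).
move: (GP); rewrite /P; set H := G0 `|` G => -[Hfun Hinj Htot Hdom].
have domν n : dom H (ν n).
  by have /domG0[z G0z] : exists m, ν n = ν m by [exists n]; exists z; left.
have /choice[g gP] : forall p, exists z, dom H p.1 -> dom H p.2 -> H (p, z).
  move=> [x y]; case: (pselect (dom H x /\ dom H y)) => [[dx dy]|nd].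
    by have [z Hz] := Htot _ _ dx dy; exists z.
  by exists x => /= dx dy; case: nd.
have gdom p : dom H p.1 -> dom H p.2 -> dom H (g p).
  by case: p => x y dx dy; have /Hdom[] := gP _ dx dy.
have ginj p q : g p = g q -> dom H p.1 -> dom H p.2 -> dom H q.1 ->
    dom H q.2 -> p = q.
  move=> pq p1 p2 q1 q2; apply: Hinj (gP _ p1 p2) _.
  by rewrite pq; apply: gP.
(* Doubling: a set split as [dom H] and an injective copy of it embeds in [dom H]. *)
have double (k : T -> T) (S : set T) :
    (forall x, S x -> ~ dom H x -> dom H (k x)) ->
    (forall x y, S x -> S y -> ~ dom H x -> ~ dom H y -> k x = k y -> x = y) ->
    exists u, (forall x, (dom H `|` S) x -> dom H (u x)) /\
      (forall x y, (dom H `|` S) x -> (dom H `|` S) y -> u x = u y -> x = y).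
  move=> kdom kinj.
  pose u x := if pselect (dom H x) then g (x, ν 0%N) else g (k x, ν 1%N).
  exists u; split=> [x|x y].
    rewrite /u; case: pselect => [dx _|dx [//|Sx]]; apply: gdom => //=.
    exact: kdom.
  have domS z : (dom H `|` S) z -> ~ dom H z -> S z by case.
  rewrite /u; case: pselect => dx; case: pselect => dy Sx Sy uxy.
  - by have [] := ginj _ _ uxy dx (domν _) dy (domν _).
  - have dk : dom H (k y) by apply: kdom => //; exact: domS.
    by have [_ /ν_inj] := ginj _ _ uxy dx (domν _) dk (domν _).
  - have dk : dom H (k x) by apply: kdom => //; exact: domS.
    by have [_ /ν_inj] := ginj _ _ uxy dk (domν _) dy (domν _).
  - have dkx : dom H (k x) by apply: kdom => //; exact: domS.
    have dky : dom H (k y) by apply: kdom => //; exact: domS.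
    have [kxy] := ginj _ _ uxy dkx (domν _) dky (domν _).
    by apply: kinj => //; exact: domS.
have [small|large] := card_le_total (~` dom H) (dom H).
  have [k [kdom kinj]] : exists k : T -> T, (forall x, ~ dom H x -> dom H (k x)) /\
      (forall x y, ~ dom H x -> ~ dom H y -> k x = k y -> x = y).
    case: (pselect (~` dom H !=set0)) => [/(card_le_ex small)[k [k1 k2]]|d0].
      by exists k; split.
    by exists id; split=> [x dx|x y dx]; case: d0; exists x.
  have [u [udom uinj]] : exists u : T -> T, (forall x, dom H (u x)) /\ injective u.
    have [u [u1 u2]] := double k setT (fun x _ => kdom x) (fun x y _ _ => kinj x y).
    by exists u; split=> [x|x y]; [apply: u1|apply: u2]; right.
  exists (fun p => g (u p.1, u p.2)) => -[x y] [x' y'] guu.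
  by have [/uinj-> /uinj->] := ginj _ _ guu (udom _) (udom _) (udom _) (udom _).
exfalso; have [h [hdom hinj]] := card_le_ex large (ex_intro _ _ (domν 0%N)).
pose S := h @` dom H.
have /choice[k kP] : forall y, exists x, S y -> dom H x /\ h x = y.
  move=> y; case: (pselect (S y)) => [[x dx hx]|nS]; first by exists x.
  by exists y.
have [u [udom uinj]] : exists u, (forall x, (dom H `|` S) x -> dom H (u x)) /\
      (forall x y, (dom H `|` S) x -> (dom H `|` S) y -> u x = u y -> x = y).
  apply: (double k S) => [x /kP[]//|x y Sx Sy _ _ kxy].
  by have [_ <-] := kP _ Sx; have [_ <-] := kP _ Sy; rewrite kxy.
pose D := dom H `|` S.
(* The pairs of [D] not yet covered by [H] are compressed into [dom H] by [u] and [g], then moved by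
   [h] into [S], away from all values of [H]. *)
pose N : set (T * T * T) := [set q | [/\ D q.1.1, D q.1.2,
  ~ (dom H q.1.1 /\ dom H q.1.2) & q.2 = h (g (u q.1.1, u q.1.2))]].
have SnH x : S x -> ~ dom H x by move=> [y dy <-]; exact: hdom.
have NS q : N q -> S q.2.
  by move=> [D1 D2 _ ->]; exists (g (u q.1.1, u q.1.2)) => //; apply: gdom; apply: udom.
have SN x : S x -> N (x, x, h (g (u x, u x))).
  by move=> Sx; split=> //=; [right|right|move=> [/(SnH _ Sx)]].
have domHN : dom (H `|` N) = D.
  rewrite predeqE => x; split.
    by move=> [z [/Hdom[dx _ _]|[/= Dx _ _ _]]] //; left.
  move=> [[z Hz]|Sx]; first by exists z; left.
  by eexists; right; apply: SN.
apply: (Gmax (G `|` N)).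
  split=> [|GN]; first exact: subsetUl.
  have S0 : S (h (ν 0%N)) by exists (ν 0%N).
  by have /Hdom[/(SnH _ S0)] : H _ := or_intror (GN _ (or_intror (SN _ S0))).
rewrite /P setUA -/H; split; rewrite ?domHN.
- move=> [x y] z z' [H1|N1] [H2|N2]; first exact: Hfun H1 H2.
  + by have [_ _ []] := N2; have [] := Hdom _ _ _ H1.
  + by have [_ _ []] := N1; have [] := Hdom _ _ _ H2.
  + by have [_ _ _ /= zE] := N1; have [_ _ _ /= zE'] := N2; rewrite zE zE'.
- move=> [x y] [x' y'] z [H1|N1] [H2|N2]; first exact: Hinj H1 H2.
  + by have /= /SnH[] := NS _ N2; have [] := Hdom _ _ _ H1.
  + by have /= /SnH[] := NS _ N1; have [] := Hdom _ _ _ H2.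
  + have [/= D1 D2 _ zE] := N1; have [/= D1' D2' _ zE'] := N2.
    have d1 : dom H (g (u x, u y)) by apply: gdom; apply: udom.
    have d2 : dom H (g (u x', u y')) by apply: gdom; apply: udom.
    have guu := hinj _ _ d1 d2 (etrans (esym zE) zE').
    have [ux uy] :=
      ginj _ _ guu (udom _ D1) (udom _ D2) (udom _ D1') (udom _ D2').
    by rewrite (uinj _ _ D1 D1' ux) (uinj _ _ D2 D2' uy).
- move=> x y Dx Dy; case: (pselect (dom H x /\ dom H y)) => [[dx dy]|nd].
    by have [z Hz] := Htot _ _ dx dy; exists z; left.
  by exists (h (g (u x, u y))); right; split.
- move=> x y z [/Hdom[dx dy dz]|/[dup] /NS /= Sz [/= Dx Dy _ _]].
    by split; left.
  by split => //; right.
Qed.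

(** Iterated pairing is injective on sequences of a fixed length only, so the length is encoded
    beside it. *)
Lemma infinite_card_seq : [set: nat] #<= [set: T] -> [set: seq T] #<= [set: T].
Proof.
move=> natT; have [g ginj] := infinite_square_inj natT.
have [ν [_ ν_inj']] := card_le_ex natT (ex_intro _ 0%N I).
have {ν_inj'} ν_inj : injective ν by move=> m n; exact: ν_inj'.
pose enc := foldr (fun x z => g (x, z)) (ν 0%N).
have enc_inj s t : size s = size t -> enc s = enc t -> s = t.
  elim: s t => [|x s IHs] [|y t] //= [/IHs{}IHs] /ginj[-> /IHs->//].
apply: inj_card_le; apply: unsquash; apply/injfunPex.
by exists (fun s => g (ν (size s), enc s)) => // s t _ _ /ginj[/ν_inj sz /(enc_inj _ _ sz)].
Qed.

End InfiniteSquare.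

(** * Closing off a countable set *)

Lemma sub_bigcup_seq (I : Type) (T : eqType) (S : I -> set T) (s : seq T) :
  inhabited I -> (forall i j, exists k, S i `<=` S k /\ S j `<=` S k) ->
  [set` s] `<=` \bigcup_i S i -> exists i, [set` s] `<=` S i.
Proof.
move=> [i0] dir; elim: s => [|x s IHs] sS; first by exists i0.
have [|j sj] := IHs; first by move=> y ys; apply: sS; rewrite /= inE (ys : y \in s) orbT.
have [i _ Six] := sS x (mem_head _ _).
have [k [ik jk]] := dir i j; exists k => y /=; rewrite inE => /orP[/eqP->|ys].
  exact: ik.
exact/jk/sj.
Qed.

Lemma nat_chain_mono (T : Type) (S : nat -> set T) :
  (forall n, S n `<=` S n.+1) -> forall m n, (m <= n)%N -> S m `<=` S n.
Proof.
move=> S1 m n /subnK <-; elim: (n - m)%N => // k IHk; rewrite addSn.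
exact: subset_trans IHk (S1 _).
Qed.

Lemma nat_chain_directed (T : Type) (S : nat -> set T) :
  (forall n, S n `<=` S n.+1) ->
  forall i j, exists k, S i `<=` S k /\ S j `<=` S k.
Proof.
move=> S1 i j; exists (maxn i j).
by split; apply: nat_chain_mono => //; rewrite ?leq_maxl ?leq_maxr.
Qed.

Lemma countable_setU (T : Type) (A B : set T) :
  countable A -> countable B -> countable (A `|` B).
Proof.
by move=> cA cB; rewrite -bigcup2E; apply: bigcup_countable => // -[|[|n]] _ //=.
Qed.

Lemma countable_seq (T : choiceType) (S : set T) :
  countable S -> countable [set s : seq T | [set` s] `<=` S].
Proof.
move=> /countable_injP[f finj]; apply/countable_injP.
exists (fun s => choice.pickle (map f s)) => s t; rewrite !inE /=.
move=> sS tS /(pcan_inj choice.pickleK).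
elim: s t sS tS => [|x s IHs] [|y t] //= sS tS [fxy fst].
have -> : x = y.
  by apply: finj fxy; rewrite inE; [apply: sS|apply: tS]; rewrite /= mem_head.
congr cons; apply: IHs fst => z zs; [apply: sS|apply: tS];
  by rewrite /= inE (zs : z \in _) orbT.
Qed.

Lemma xget_default (T : choiceType) (P : set T) (x y : T) :
  P !=set0 -> xget x P = xget y P.
Proof.
by move=> [z Pz]; rewrite /xget; case: pselect => // -[]; exists z; apply/asboolP.
Qed.

Section Hull.
Variables (T : choiceType) (V : seq T -> nat -> set T).

Let code := seq (seq T * nat).

Definition cylinder (c : code) : set T := [set x | forall t, t \in c -> V t.1 t.2 x].

Definition code_in (S : set T) (c : code) := [set` flatten (unzip1 c)] `<=` S.

Lemma code_inP (S : set T) (c : code) :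
  code_in S c <-> forall t, t \in c -> [set` t.1] `<=` S.
Proof.
split=> [cS t tc x xt|cS x /flattenP[s /mapP[t tc ->] xt]]; last exact: cS tc _ _.
by apply: cS; apply/flattenP; exists t.1 => //; apply: map_f.
Qed.

Lemma countable_code_in (S : set T) : countable S -> countable (code_in S).
Proof.
move=> cS; have cSN := countableX (countable_seq cS) (countableP [set: nat]).
apply: sub_countable (countable_seq cSN); apply: subset_card_le => c /code_inP cSc.
by move=> t /cSc.
Qed.

(* [xget x P = x] for [x] in [P] selects one point of [P]; this form of the
   choice needs no default element when [T] is empty. *)
Fixpoint hull_stage (F : set (set T)) (n : nat) : set T :=
  if n is m.+1 then
    [set x | exists C c, [/\ F C, code_in (hull_stage F m) c, (C `&` cylinder c) x
                           & x = xget x (C `&` cylinder c)]]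
  else set0.

Definition hull (F : set (set T)) : set T := \bigcup_n hull_stage F n.

Lemma code_in_mono (S S' : set T) c : S `<=` S' -> code_in S c -> code_in S' c.
Proof. by move=> SS' cS; apply: subset_trans cS SS'. Qed.

Lemma hull_stageS F n : hull_stage F n `<=` hull_stage F n.+1.
Proof.
elim: n => [|n IHn] x //= [C [c [FC cn Cx xE]]].
by exists C, c; split=> //; apply: code_in_mono cn.
Qed.

Lemma hull_stage_mono F F' n : F `<=` F' -> hull_stage F n `<=` hull_stage F' n.
Proof.
move=> FF'; elim: n => [|n IHn] x //= [C [c [FC cn Cx xE]]].
by exists C, c; split=> //; [exact: FF'|apply: code_in_mono cn].
Qed.

Lemma hull_mono F F' : F `<=` F' -> hull F `<=` hull F'.
Proof. by move=> FF'; apply: subset_bigcup => n _; apply: hull_stage_mono. Qed.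

(** A point enters a stage through one member of the family and finitely many points of the previous
    stage, all of which are present at a single index of the chain. *)
Lemma hull_bigcup (F : nat -> set (set T)) : (forall n, F n `<=` F n.+1) ->
  hull (\bigcup_n F n) = \bigcup_n hull (F n).
Proof.
move=> F1; rewrite eqEsubset; split; last first.
  by apply: bigcup_sub => n _; apply: hull_mono; exact: bigcup_sup.
have stage m : hull_stage (\bigcup_n F n) m `<=` \bigcup_n hull_stage (F n) m.
  elim: m => [|m IHm] x //= [C [c [[i _ FC] cm Cx xE]]].
  have mono n : hull_stage (F n) m `<=` hull_stage (F n.+1) m.
    exact: hull_stage_mono.
  have [j cj] := sub_bigcup_seq (inhabits 0%N) (nat_chain_directed mono)
    (subset_trans cm IHm).
  exists (maxn i j) => //; exists C, c; split=> //.
    by apply: (nat_chain_mono F1) FC; rewrite leq_maxl.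
  apply: code_in_mono (cj : code_in _ _).
  by apply: hull_stage_mono; apply: (nat_chain_mono F1); rewrite leq_maxr.
by move=> x [m _ /stage[n _ xnm]]; exists n => //; exists m.
Qed.

Lemma countable_hull F : countable F -> countable (hull F).
Proof.
move=> cF; apply: bigcup_countable => // n _; elim: n => [|n IHn] //=.
pose pick (p : set T * code) : set T := [set x | (p.1 `&` cylinder p.2) x
  /\ x = xget x (p.1 `&` cylinder p.2)].
apply: (@sub_countable _ _ _ (\bigcup_(p in F `*` code_in (hull_stage F n)) pick p)).
  apply: subset_card_le => x [C [c [FC cn Cx xE]]].
  by exists (C, c).
apply: bigcup_countable => [|p _]; first exact/countableX/countable_code_in.
(* [pick p] has at most one point, as [xget] on a nonempty set ignores its default; hence it embeds
   in a singleton. *)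
apply: sub_countable (countable1 tt); apply: (@card_le_rel _ _ _ _ (fun _ _ => True)).
  by move=> x _; exists tt.
move=> x y _ [px xE] [_ yE] _ _; rewrite xE yE.
by apply: xget_default; exists x.
Qed.

Lemma hull_sub F : hull F `<=` \bigcup_(C in F) C.
Proof. by move=> x [[|n] _ //= [C [c [FC _ [Cx _] _]]]]; exists C. Qed.

(** A code mentions finitely many points, so it lies over one stage, and the next stage contains the
    selected point. *)
Lemma hull_meets F C c : F C -> code_in (hull F) c -> C `&` cylinder c !=set0 ->
  exists x, [/\ hull F x, C x & cylinder c x].
Proof.
move=> FC cF [x Cx].
have [n cn] := sub_bigcup_seq (inhabits 0%N)
  (nat_chain_directed (@hull_stageS F)) cF.
have [Cy cy] := xgetI x Cx; exists (xget x (C `&` cylinder c)); split=> //.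
exists n.+1 => //; exists C, c; split=> //.
by apply: xget_default; exists x.
Qed.

End Hull.

(** * Finitary networks *)

Section Finitary.
Variable K : topologicalType.
Implicit Types (A C E : set K) (e V : seq K -> nat -> set K).

Definition generated e A : set (set K) :=
  [set N | exists s n, [set` s] `<=` A /\ N = e s n].

Definition finitary_network e :=
  forall A, countable A -> external_network (generated e A) (closure A).

Lemma generated_mono e A B : A `<=` B -> generated e A `<=` generated e B.
Proof.
by move=> AB N [s [n [sA ->]]]; exists s, n; split=> //; apply: subset_trans AB.
Qed.

Lemma countable_generated e A : countable A -> countable (generated e A).
Proof.
move=> cA; have c := countableX (countable_seq cA) (countableP [set: nat]).
apply: sub_countable c.
apply: card_le_trans (card_image_le (fun p => e p.1 p.2) _).
by apply: subset_card_le => N [s [n [sA ->]]]; exists (s, n).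
Qed.

Lemma generated_bigcup e (I : Type) (A : I -> set K) : inhabited I ->
  (forall i j, exists k, A i `<=` A k /\ A j `<=` A k) ->
  generated e (\bigcup_i A i) = \bigcup_i generated e (A i).
Proof.
move=> I0 dir; rewrite eqEsubset; split; last first.
  by apply: bigcup_sub => i _; apply: generated_mono; exact: bigcup_sup.
move=> N [s [n [sA ->]]]; have [i si] := sub_bigcup_seq I0 dir sA.
by exists i => //; exists s, n.
Qed.

Lemma external_network_sub (F G : set (set K)) A B : F `<=` G -> B `<=` A ->
  external_network F A -> external_network G B.
Proof.
move=> FG BA netF b Bb U oU Ub; have [N FN NU] := netF b (BA b Bb) U oU Ub.
by exists N => //; exact: FG.
Qed.

(** Let [e s] list the value of [G] at the finite set of entries of [s]. A countable set is the
    union of the chain of initial segments of an enumeration, so continuity recovers [G A] from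
    these lists. *)
Lemma finitary_of_chain_continuous (G : set K -> set (set K)) :
  (forall A, countable A -> countable (G A)) ->
  (forall A, countable A -> external_network (G A) (closure A)) ->
  (forall A : nat -> set K, (forall n, countable (A n)) ->
     (forall n, A n `<=` A n.+1) -> G (\bigcup_n A n) = \bigcup_n G (A n)) ->
  exists e, finitary_network e.
Proof.
move=> cG netG contG.
(* An inclusion is enough, because enlarging a network keeps it a network; [set0] fills the list
   when [G] has no members to offer. *)
have /choice[e eP] : forall s : seq K, exists f : nat -> set K,
    G [set` s] `<=` range f.
  move=> s; have := cG _ (finite_set_countable (finite_seq s)).
  move=> /pfcard_geP[->|[f]]; first by exists (fun _ => set0).
  by exists f => N /(@surj _ _ _ _ f)[n _ <-]; exists n.
exists e => A cA; have /pfcard_geP[A0|[f]] := cA.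
  by rewrite A0 closure0 => a.
pose S n : set K := [set` mkseq f n].
have S1 n : S n `<=` S n.+1.
  by move=> x; rewrite /S /= /mkseq -addn1 iotaD map_cat mem_cat => ->.
have AE : A = \bigcup_n S n.
  rewrite eqEsubset; split=> [x /(@surj _ _ _ _ f)[n _ <-]|x [n _ /mapP[m _ ->]]].
    by exists n.+1 => //; rewrite /S /= map_f // mem_iota add0n ltnSn.
  exact: funS.
apply: external_network_sub (netG A cA) => //.
rewrite [X in G X]AE contG //; last by move=> n; apply/finite_set_countable/finite_seq.
move=> N [n _ /eP[k _ <-]]; exists (mkseq f n), k; split=> //.
by move=> x /mapP[m _ ->]; exact: funS.
Qed.

(* Compactness: a point which [E] approximates along all finite intersections of
   sets [V s n] with [s] in [A] has a companion in [E] that these sets do not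
   separate from it. *)
Lemma compact_companion V E A (x : K) : compact E ->
  (forall c, code_in A c -> cylinder V c x -> E `&` cylinder V c !=set0) ->
  exists2 y, E y & forall s n, [set` s] `<=` A -> V s n x -> closure (V s n) y.
Proof.
move=> cE Ex.
pose G := filter_from [set c | code_in A c /\ cylinder V c x] (fun c => E `&` cylinder V c).
have FG : ProperFilter G.
  apply: filter_from_proper => [|c [cA cx]]; last exact: Ex.
  apply: filter_from_filter.
    by exists [::]; split=> [y|t].
  move=> c d [/code_inP cA cx] [/code_inP dA dx]; exists (c ++ d).
    split=> [|t]; last by rewrite mem_cat => /orP[/cx|/dx].
    by apply/code_inP => t; rewrite mem_cat => /orP[/cA|/dA].
  move=> y [Ey ycd]; split; split=> // t tc; apply: ycd; rewrite mem_cat tc ?orbT//.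
have GE : G E.
  by exists [::]; [split=> [y|t]|move=> y []].
have [y [Ey yG]] := cE G FG GE.
exists y => // s n sA Vx; move: yG; rewrite clusterE; apply.
exists [:: (s, n)]; last by move=> z [_ /(_ (s, n))]; apply; rewrite mem_head.
split; first by apply/code_inP => t; rewrite inE => /eqP->.
by move=> t; rewrite inE => /eqP->.
Qed.

Hypotheses (hK : hausdorff_space K) (cK : compact [set: K]).

Lemma closure_compact A : compact (closure A).
Proof. by apply: subclosed_compact cK _ => //; exact: closed_closure. Qed.

Lemma nbhs_cylinder V (c : seq (seq K * nat)) (x : K) : (forall t, t \in c -> nbhs x (V t.1 t.2)) ->
  nbhs x (cylinder V c).
Proof.
elim: c => [|t c IHc] H; first by apply: filterS filterT => y _ t.
have : nbhs x (V t.1 t.2 `&` cylinder V c).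
  apply: filterI; first by apply: H; rewrite mem_head.
  by apply: IHc => u uc; apply: H; rewrite inE uc orbT.
by apply: filterS => y [Vy cy] u; rewrite inE => /orP[/eqP->|/cy].
Qed.

(** The companion [y] of [z] in the closure of the hull equals [z]. Otherwise some member [e s n]
    containing [y] lies in an open set disjoint from a neighbourhood of [z], and then the closure of
    [V s n] misses [e s n] although it contains [y]. *)
Lemma countably_tight e (X : set K) (z : K) : finitary_network e -> closure X z ->
  exists A, [/\ countable A, A `<=` X & closure A z].
Proof.
move=> net Xz.
(* [setT] is the default for those [N] that no neighbourhood of [z] avoids with its closure. *)
have /choice[W WP] : forall N : set K, exists W : set K, nbhs z W /\
    ((exists2 U, nbhs z U & closure U `&` N = set0) -> closure W `&` N = set0).
  move=> N; case: (pselect (exists2 U, nbhs z U & closure U `&` N = set0)).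
    by move=> [U zU UN]; exists U.
  by move=> nU; exists setT; split=> //; exact: filterT.
pose V s n := W (e s n).
have zV c : nbhs z (cylinder V c) by apply: nbhs_cylinder => t _; exact: (WP _).1.
pose A := hull V [set X].
have cA : countable A by apply: countable_hull; exact: countable1.
have AX : A `<=` X by move=> x /hull_sub[C ->].
exists A; split=> //.
have [c cA' _|y Ay yV] := @compact_companion V (closure A) A z (@closure_compact A).
  have [x [Ax Xx cx]] := hull_meets (erefl : [set X] X) cA' (Xz _ (zV c)).
  by exists x; split=> //; exact: subset_closure.
suff -> : z = y by [].
apply: hK => P Q zP yQ; apply: contrapT => PQ0.
have [U [oU Uy] UQ] : exists2 U, open U /\ U y & U `<=` Q.
  by move: yQ; rewrite nbhsE => -[U [oU Uy] UQ]; exists U.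
have [_ [s [n [sA ->]]] [Ny NU]] := net A cA y Ay U oU Uy.
have WN : closure (V s n) `&` e s n = set0.
  apply: (WP _).2; exists P => //; rewrite -subset0 => x [Px /NU Ux].
  have [w [Pw Uw]] := Px U (open_nbhs_nbhs (conj oU Ux)).
  by apply: PQ0; exists w; split=> //; exact: UQ.
have : (closure (V s n) `&` e s n) y.
  by split=> //; apply: yV => //; apply: nbhs_singleton; exact: (WP _).1.
by rewrite WN.
Qed.

(** Countable tightness places each point of the closure of [A] in the closure of a countable subset
    of [A], where [e] supplies the network. *)
Lemma finitary_mono_monolithic e : finitary_network e -> mono_monolithic K.
Proof.
move=> net κ _.
(* Requiring a point of [A] makes [O set0] empty, as the chain condition with
   the empty cardinal demands. *)
exists (fun A => [set N | A !=set0 /\ generated e A N]).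
split.
- move=> A _ a /(countably_tight net)[B [cB BA Ba]] U oU Ua.
  have [N BN NU] := net B cB a Ba U oU Ua; exists N => //.
  have [b [Bb _]] := Ba _ filterT.
  by split; [exists b; exact: BA|exact: generated_mono BN].
- move=> A _; set S := _ `|` _.
  apply: (@card_le_trans _ _ _ [set: seq S]); last first.
    apply: card_le_trans (_ : [set: S] #<= S); last by have /card_eqPle[] := card_setT S.
    apply: infinite_card_seq.
    apply: (@card_le_rel _ _ _ _ (fun n (x : S) => val x = inr n)) => [n _|n n' x _ _ -> []//].
    have Sn : inr n \in S by rewrite inE; right; exists n.
    by exists (Sub (inr n) Sn).
  (* A set [e s n] is coded by [inr n] followed by the entries of [s]. The code is a relation
     because one set may arise from several pairs [s], [n]. *)
  apply: (@card_le_rel _ _ _ _ (fun N (l : seq S) => exists s n,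
    map val l = inr n :: map inl s /\ N = e s n)).
    move=> _ [_ [s [n [sA ->]]]].
    have [l lE] : exists l : seq S, map val l = map inl s.
      elim: s sA => [|x s IHs] sA; first by exists [::].
      have [|l lE] := IHs.
        by move=> y ys; apply: sA; rewrite /= inE (ys : y \in s) orbT.
      have Sx : inl x \in S.
        by rewrite inE; left; exists x => //; apply: sA; rewrite /= mem_head.
      by exists (Sub (inl x) Sx :: l); rewrite /= lE.
    have Sn : inr n \in S by rewrite inE; right; exists n.
    by exists (Sub (inr n) Sn :: l) => //; exists s, n; rewrite /= lE.
  move=> N N' l _ _ [s [n [-> ->]]] [s' [n' [[<- ss'] ->]]].
  suff -> : s = s' by [].
  by apply: inj_map ss' => x y [].
- move=> A B AB _ N [[a Aa] AN]; split; first by exists a; exact: AB.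
  exact: generated_mono AN.
- move=> W lt Ach [_ _ tot _ _] _ _ Amono.
  have dir i j : exists k, Ach i `<=` Ach k /\ Ach j `<=` Ach k.
    have [->|[/Amono ij|/Amono ji]] := tot i j; first by exists j; split.
      by exists j; split.
    by exists i; split.
  rewrite eqEsubset; split.
    move=> N [[a [i0 _ ai0]]]; rewrite (generated_bigcup _ (inhabits i0) dir).
    move=> [i _ Ni]; have [k [i0k ik]] := dir i0 i; exists k => //.
    by split; [exists a; exact: i0k|exact: generated_mono Ni].
  move=> N [i _ [[a Aia] Ni]]; split; first by exists a, i.
  by apply: generated_mono Ni; exact: bigcup_sup.
Qed.

End Finitary.

(** * Retractions *)

Section Retraction.
Variable K : topologicalType.
Hypotheses (hK : hausdorff_space K) (cK : compact [set: K]).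
Variable e : seq K -> nat -> set K.
Hypothesis net : finitary_network e.

Variable R : realType.

(** Closures are taken because Urysohn's lemma separates closed sets; the function is continuous in
    all cases, but separation is guaranteed only for disjoint closures. *)
Definition sep (N M : set K) : K -> R := Urysohn (closure N) (closure M).

Lemma sep_continuous N M : continuous (sep N M).
Proof. exact: Urysohn_continuous. Qed.

Lemma sep_neq N M x y : closure N `&` closure M = set0 -> N x -> M y ->
  sep N M x <> sep N M y.
Proof.
move=> NM Nx My.
have us : uniform_separator (closure N) (closure M).
  apply: normal_uniform_separator => //; try exact: closed_closure.
  exact: compact_normal.
have -> : sep N M x = 0%R.
  by apply: (Urysohn_sub0 us); exists x => //; exact: subset_closure.
have -> : sep N M y = 1%R.
  by apply: (Urysohn_sub1 us); exists y => //; exact: subset_closure.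
by apply/eqP; rewrite eq_sym oner_eq0.
Qed.

(* [n] encodes where to cut [s] into the arguments of two members [e s1 i] and
   [e s2 j] of the network, and a rational half-line. *)
Definition halfspace (s : seq K) (n : nat) : set K :=
  match choice.unpickle n : option (nat * nat * nat * bool * rat) with
  | Some (k, i, j, below, q) =>
      let f := sep (e (take k s) i) (e (drop k s) j) in
      if below then [set x | (f x < ratr q)%R] else [set x | (ratr q < f x)%R]
  | None => setT
  end.

Lemma open_halfspace s n : open (halfspace s n).
Proof.
rewrite /halfspace; case: choice.unpickle => [[[[[k i] j] b] q]|]; last exact: openT.
have c := @sep_continuous (e (take k s) i) (e (drop k s) j).
case: b; [have := open_comp (fun x _ => c x) (@open_lt R (ratr q))|
          have := open_comp (fun x _ => c x) (@open_gt R (ratr q))]; exact.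
Qed.

Definition agree (A : set K) (x y : K) := forall s1 s2 i j,
  [set` s1] `<=` A -> [set` s2] `<=` A ->
  sep (e s1 i) (e s2 j) x = sep (e s1 i) (e s2 j) y.

(** If two values differed, a rational strictly between them would bound an open half-line
    containing the value at [x], whose closure excludes the value at [y]. *)
Lemma agree_companion A x y :
  (forall s n, [set` s] `<=` A -> halfspace s n x -> closure (halfspace s n) y) ->
  agree A x y.
Proof.
move=> xy s1 s2 i j s1A s2A; set f := sep _ _.
have cf : continuous f by exact: sep_continuous.
have sA : [set` s1 ++ s2] `<=` A.
  by move=> z; rewrite /= mem_cat => /orP[/s1A|/s2A].
pose n (b : bool) (q : rat) := choice.pickle (size s1, i, j, b, q).
have nE b q : halfspace (s1 ++ s2) (n b q) =
    if b then [set x | (f x < ratr q)%R] else [set x | (ratr q < f x)%R].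
  by rewrite /halfspace /n choice.pickleK take_size_cat // drop_size_cat.
apply/eqP; rewrite eq_le; apply/andP; split; rewrite leNgt; apply/negP.
- move=> /rat_in_itvoo[q]; rewrite in_itv /= => /andP[yq qx].
  have := xy _ (n false q) sA; rewrite nE => /(_ qx) ycl.
  have : [set z | (ratr q <= f z)%R] y.
    have cl : closed [set z | (ratr q <= f z)%R].
      exact: closed_comp (fun z _ => cf z) (@closed_ge R (ratr q)).
    by apply: cl; apply: closureS ycl => z /= /ltW.
  by rewrite /= leNgt yq.
- move=> /rat_in_itvoo[q]; rewrite in_itv /= => /andP[xq qy].
  have := xy _ (n true q) sA; rewrite nE => /(_ xq) ycl.
  have : [set z | (f z <= ratr q)%R] y.
    have cl : closed [set z | (f z <= ratr q)%R].
      exact: closed_comp (fun z _ => cf z) (@closed_le R (ratr q)).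
    by apply: cl; apply: closureS ycl => z /= /ltW.
  by rewrite /= leNgt qy.
Qed.

(** By regularity, distinct points have neighbourhoods with disjoint closures; network members
    inside these give a function [sep] with different values at the two points. *)
Lemma agree_eq A x y : countable A -> closure A x -> closure A y ->
  agree A x y -> x = y.
Proof.
move=> cA Ax Ay xy; apply: contrapT => /eqP xNy.
have sepK := hK; rewrite open_hausdorff in sepK.
have [[P Q] [/= /set_mem Px /set_mem Qy] [oP oQ /eqP PQ]] := sepK x y xNy.
have regular (z : K) (U : set K) : open U -> U z -> exists2 G, open G /\ G z & closure G `<=` U.
  move=> oU Uz.
  have [W zW WU] := compact_regular hK cK filterT (open_nbhs_nbhs (conj oU Uz)).
  have [G [oG Gz] GW] : exists2 G, open_nbhs z G & G `<=` W.
    by move: zW; rewrite nbhsE.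
  by exists G => //; apply: subset_trans WU; exact: closureS.
have [G [oG Gx] GP] := regular x P oP Px.
have [H [oH Hy] HQ] := regular y Q oQ Qy.
have [_ [s1 [i [s1A ->]]] [N1x N1G]] := net cA Ax oG Gx.
have [_ [s2 [j [s2A ->]]] [N2y N2H]] := net cA Ay oH Hy.
apply: (@sep_neq _ _ x y _ N1x N2y); last exact: xy.
rewrite -subset0 -PQ => z [z1 z2]; split.
  exact/GP/(closureS N1G).
exact/HQ/(closureS N2H).
Qed.

(** Every point has a companion in [closure A], since [F] contains [setT], and by [agree_eq] only
    one point there agrees with it. A companion found inside a member [C] of [F] is therefore the
    value of [r], so [r] preserves [C]. *)
Lemma hull_retraction (F : set (set K)) (A := hull halfspace F) :
  countable F -> (forall C, F C -> closed C) -> F setT ->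
  exists r : K -> K, [/\ continuous r, forall x, r (r x) = r x,
    range r `<=` closure A & forall C, F C -> r @` C `<=` C].
Proof.
move=> cF clF FT; have cA : countable A by exact: countable_hull.
have clAC C : closed C -> compact (closure A `&` C).
  move=> clC; apply: subclosed_compact cK _ => //.
  by apply: closedI => //; exact: closed_closure.
have proj C x : F C -> C x -> exists y, [/\ closure A y, C y & agree A x y].
  move=> FC Cx.
  have [c cAc xc|y [Ay Cy] /agree_companion] :=
    @compact_companion _ halfspace _ A x (clAC C (clF C FC)).
    have [y [Ay Cy cy]] := hull_meets FC cAc (ex_intro _ x (conj Cx xc)).
    by exists y; split=> //; split=> //; exact: subset_closure.
  by exists y.
have /choice[r rP] x : exists y, closure A y /\ agree A x y.
  by have [y [Ay _ xy]] := proj setT x FT I; exists y.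
have r_uniq x y : closure A y -> agree A x y -> r x = y.
  move=> Ay xy; have [Ar xr] := rP x.
  apply: (agree_eq cA Ar Ay) => s1 s2 i j s1A s2A.
  by rewrite -xr // xy.
exists r; split.
(* A cylinder around [x] contains some [x'] with [r x'] in [D], and [r x'] lies in the same
   half-spaces over [A] as [x']. So [x] has a companion in [D], which must be [r x]. *)
- apply/continuous_closedP => D clD x xD.
  have [c cAc xc|y [Ay Dy] /agree_companion xy] :=
    @compact_companion _ halfspace _ A x (clAC D clD).
    have nc : nbhs x (cylinder halfspace c).
      apply: nbhs_cylinder => t tc; apply: open_nbhs_nbhs; split.
        exact: open_halfspace.
      exact: xc.
    have [x' [Dx' cx']] := xD _ nc.
    have [Ar xr] := rP x'; exists (r x'); split=> // t tc.
    have := cx' t tc; move/code_inP: cAc => /(_ t tc) tA.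
    rewrite /halfspace.
    case: choice.unpickle => // -[[[[k i] j] b] q] /=.
    have fE := xr (take k t.1) (drop k t.1) i j
      (fun u ut => tA u (mem_take ut)) (fun u ut => tA u (mem_drop ut)).
    by case: b; rewrite /= fE.
  by rewrite /preimage /= (r_uniq x y).
- by move=> x; apply: r_uniq; [exact: (rP x).1|].
- by move=> _ [x _ <-]; exact: (rP x).1.
- by move=> C FC _ [x Cx <-]; have [y [Ay Cy /(r_uniq _ _ Ay)->]] := proj C x FC Cx.
Qed.

Lemma finitary_mono_Sokolov : mono_Sokolov K.
Proof.
(* [setT] is added to make the retraction defined everywhere, as [hull_retraction] demands. *)
pose F1 (F : set (set K)) := F `|` [set setT].
pose A F := hull halfspace (F1 F).
have F1c F : countable_closed_families F -> countable (F1 F).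
  by move=> [cF _]; apply: countable_setU => //; exact: countable1.
have /choice[r rP] F : exists r : K -> K, countable_closed_families F ->
    [/\ continuous r, forall x, r (r x) = r x,
    range r `<=` closure (A F) & forall C, F C -> r @` C `<=` C].
  case: (pselect (countable_closed_families F)) => [DF|nF]; last by exists id.
  have [|||r [r1 r2 r3 r4]] := @hull_retraction (F1 F).
  - exact: F1c.
  - by move=> C [/DF.2//|->]; exact: closedT.
  - by right.
  - by exists r => _; split=> // C FC; apply: r4; left.
exists r, (fun F => generated e (A F)); split; last split.
- move=> F DF; have [r1 r2 r3 r4] := rP F DF.
  have cA : countable (A F) by apply: countable_hull; exact: F1c.
  split=> //; first exact: countable_generated.
  exact: external_network_sub (net cA).
- by move=> F DF _; apply: countable_generated; apply: countable_hull; exact: F1c.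
- by move=> F F' _ _ FF'; apply/generated_mono/hull_mono; exact: setSU.
- move=> F DF F_incr.
  have FE : F1 (\bigcup_n F n) = \bigcup_n F1 (F n).
    rewrite eqEsubset; split=> C.
      by move=> [[n _ FC]|->]; [exists n => //; left|exists 0%N => //; right].
    by move=> [n _ [FC|->]]; [left; exists n|right].
  have F1S n : F1 (F n) `<=` F1 (F n.+1) by exact: setSU.
  rewrite /A FE hull_bigcup // (generated_bigcup _ (inhabits 0%N)) //.
  by apply: nat_chain_directed => n; exact: hull_mono.
Qed.

End Retraction.

(** * Finitary networks from the monolithic and Sokolov properties, and the equivalence *)

Lemma cardinal_wo_nat : cardinal_wo (fun m n => (m < n)%N).
Proof.
split.
- by move=> n; rewrite ltnn.
- by move=> m n p; exact: ltn_trans.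
- by move=> m n; case: (ltngtP m n) => [mn|nm|->]; [right; left|right; right|left].
- by elim/ltn_ind => n IHn; constructor=> m; exact: IHn.
- move=> n le_n; apply: infinite_nat.
  exact: card_le_finite le_n (finite_II n).
Qed.

Lemma mono_omega_monolithic_finitary (K : topologicalType) :
  mono_omega_monolithic K -> exists e : seq K -> nat -> set K, finitary_network e.
Proof.
move=> [G [netG cG _ contG]]; apply: (@finitary_of_chain_continuous _ G).
- move=> A cA; apply: sub_countable (cG A cA) _; apply: countable_setU.
  + exact: sub_countable (card_image_le _ _) cA.
  + exact: sub_countable (card_image_le _ _) _.
- exact: netG.
- move=> A cA A1; apply: (contG nat (fun m n => (m < n)%N)).
  + exact: cardinal_wo_nat.
  + exact: card_lexx.
  + exact: cA.
  + by move=> m n /ltnW; exact: nat_chain_mono.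
Qed.

(** A retraction preserving each singleton from [A] fixes [A] pointwise. Its range is its set of
    fixed points, closed in a Hausdorff space, and so contains the closure of [A]. *)
Lemma mono_Sokolov_finitary (K : topologicalType) :
  hausdorff_space K -> mono_Sokolov K ->
  exists e : seq K -> nat -> set K, finitary_network e.
Proof.
move=> hK [r [Nw [rP [_ _ contN]]]].
pose pts (A : set K) : set (set K) := [set [set a] | a in A].
have Dpts A : countable A -> countable_closed_families (pts A).
  move=> cA; split; first exact: sub_countable (card_image_le _ _) cA.
  move=> _ [a _ <-]; exact/accessible_closed_set1/hausdorff_accessible.
apply: (@finitary_of_chain_continuous _ (fun A => Nw (pts A))).
- by move=> A /Dpts/rP[].
- move=> A /Dpts/rP[cr rr _ net fix_r]; apply: external_network_sub net => //.
  have rE : range (r (pts A)) = [set x | r (pts A) x = x].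
    rewrite eqEsubset; split=> [_ [x _ <-]|x /= <-]; first exact: rr.
    by exists x.
  rewrite rE; have clr : closed [set x | r (pts A) x = x].
    move=> x xS; apply: hK => U W rU xW.
    have rU' : nbhs x (r (pts A) @^-1` U) := cr x U rU.
    have [s [/= sS [sU sW]]] := xS _ (filterI rU' xW).
    by exists s; split=> //; rewrite -sS.
  move=> x Ax; apply: clr; apply: closureS Ax => a Aa /=.
  by apply: (fix_r [set a]); [exists a|exists a].
- move=> A cA A1; rewrite -contN; last first.
  + by move=> n; apply: image_subset.
  + by move=> n; exact: Dpts.
  by rewrite /pts image_bigcup.
Qed.

Theorem theorem1p1 (K : topologicalType) :
  hausdorff_space K -> compact [set: K] ->
  (mono_monolithic K <-> mono_omega_monolithic K) /\
  (mono_omega_monolithic K <-> mono_Sokolov K).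
Proof.
move=> hK cK.
have mono_omega : mono_monolithic K -> mono_omega_monolithic K.
  by apply; exact: infinite_nat.
have finitary_mono : (exists e : seq K -> nat -> set K, finitary_network e) ->
    mono_monolithic K.
  by move=> [e]; exact: finitary_mono_monolithic.
split; split=> //.
- by move=> /mono_omega_monolithic_finitary/finitary_mono.
(* The Sokolov property mentions no reals; a concrete real field is supplied for the values of the
   Urysohn functions. *)
- move=> /mono_omega_monolithic_finitary[e net]; exact: (finitary_mono_Sokolov hK cK net Rdefinitions.R).
- by move=> /(mono_Sokolov_finitary hK)/finitary_mono/mono_omega.
Qed.
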